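(* For every $\epsilon>0$ there exist $\delta=\delta(\epsilon)>0$ and $n_0=n_0(\epsilon)$ such that for every positive integer $n\ge n_0$ there is an ordered graph $G$ on $n$ vertices with maximum degree $\Delta(G)\le \epsilon n$ such that the largest bi-clique in the complement $\overline{G}$ has size at most $n^{1-\delta}$, and $G$ contains neither of the following two ordered graphs as an induced ordered subgraph: the ordered graph $S$ on vertices $1\prec 2\prec 3\prec 4$ with edge set $\{\{1,2\},\{1,3\},\{1,4\}\}$, and the ordered graph $P$ on vertices $1\prec2\prec3\prec4$ with edge set $\{\{1,4\},\{1,3\},\{2,3\}\}$.
   Context: An ordered graph is a graph together with a total ordering $\prec$ of its vertex set. An ordered graph $H$ is an induced ordered subgraph of an ordered graph $G$ if there is an order-preserving injection $V(H)\to V(G)$ mapping edges to edges and non-edges to non-edges. $\overline{G}$ denotes the complement of $G$. For disjoint sets $A,B$ of vertices, $A$ is complete to $B$ if every vertex of $A$ is adjacent to every vertex of $B$; if moreover $|A|=|B|=s$, then $(A,B)$ is a bi-clique of size $s$. $\Delta(G)$ denotes the maximum degree of $G$. *)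

(* Defs.v *)
From HB Require Import structures.
From mathcomp Require Import all_boot all_order all_algebra.
From mathcomp Require Import reals exp.

Set Implicit Arguments.
Unset Strict Implicit.
Unset Printing Implicit Defensive.

Import Order.TTheory.

Record ordered_graph := OrderedGraph {
  graph_disp : Order.disp_t;
  vertex :> finOrderType graph_disp;
  adj : rel vertex;
  adj_sym : symmetric adj;
  adj_irr : irreflexive adj }.

Definition induced_ordered_subgraph (H G : ordered_graph) : Prop :=
  exists f : H -> G,
    [/\ injective f,
        {homo f : x y / (x <= y)%O} &
        forall x y : H, adj (f x) (f y) = adj x y].

Section Complement.
Variable G : ordered_graph.

Definition compl_adj : rel G := fun x y => (x != y) && ~~ adj x y.

Lemma compl_adj_sym : symmetric compl_adj.
Proof. by move=> x y; rewrite /compl_adj eq_sym adj_sym. Qed.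

Lemma compl_adj_irr : irreflexive compl_adj.
Proof. by move=> x; rewrite /compl_adj eqxx. Qed.

Definition complement : ordered_graph :=
  OrderedGraph compl_adj_sym compl_adj_irr.

End Complement.

Definition max_degree (G : ordered_graph) : nat :=
  \max_(x : G) #|[set y | adj x y]|.

Definition complete_to (G : ordered_graph) (A B : {set G}) : bool :=
  [forall x in A, forall y in B, adj x y].

Definition biclique (G : ordered_graph) (A B : {set G}) : bool :=
  [&& [disjoint A & B], #|A| == #|B| & complete_to A B].

(* The pair (set0, set0) always qualifies, so this is a genuine maximum. *)
Definition max_biclique_size (G : ordered_graph) : nat :=
  \max_(AB : {set G} * {set G} | biclique AB.1 AB.2) #|AB.1|.

Section FromEdges.
Variables (k : nat) (E : seq (nat * nat)).

(* The vertex i : 'I_k carries the label i.+1, so labels run over 1, ..., k. *)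
Definition edges_adj : rel 'I_k := fun i j =>
  (i != j) && (((i.+1, j.+1) \in E) || ((j.+1, i.+1) \in E)).

Lemma edges_adj_sym : symmetric edges_adj.
Proof. by move=> i j; rewrite /edges_adj eq_sym orbC. Qed.

Lemma edges_adj_irr : irreflexive edges_adj.
Proof. by move=> i; rewrite /edges_adj eqxx. Qed.

Definition graph_of_edges : ordered_graph :=
  OrderedGraph edges_adj_sym edges_adj_irr.

End FromEdges.

Definition graph_S : ordered_graph :=
  graph_of_edges 4 [:: (1, 2); (1, 3); (1, 4)].

Definition graph_P : ordered_graph :=
  graph_of_edges 4 [:: (1, 4); (1, 3); (2, 3)].

(* Main.v *)
Require Import Defs.
From HB Require Import structures.
From mathcomp Require Import all_boot all_order all_algebra.
From mathcomp Require Import reals exp.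
From mathcomp Require Import zify.

(* Cut [n] into k ~ 4/eps consecutive intervals ("layers") and make each layer a
   clique; between layers put a sparse relation E, directed upwards, such that
   (i) any two sets of size s, the first in a lower layer than the second, are
   joined by a pair of E, and (ii) if E a x and E a y with x in a lower layer
   than y, then E x y.  By (i) and pigeonhole a bi-clique of the complement has
   size at most k s.  By (ii) two vertices above a that are adjacent to a are
   adjacent to each other as soon as the lower one is outside the layer of a,
   and this excludes both S and P.
   For (i) take 3 r^2 random maps, where r s >= 2 n, and drop the points of large
   in-degree; for (ii) close up one layer at a time from below.  Each step
   roughly squares the degrees, so they end up below (12 r^2)^(2^k), which is
   o(n) if r is about n^(1/(4 2^k)). *)

Set Implicit Arguments.
Unset Strict Implicit.
Unset Printing Implicit Defensive.

Import Order.TTheory GRing.Theory Num.Theory.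

(** * Sparse mixing relations by counting random maps *)

Lemma double_expn_pred r : 0 < r -> 2 * r.-1 ^ r <= r ^ r.
Proof.
case: r => // -[//|q] _ /=.
(* Bernoulli's inequality (1 + 1/(q+1))^m >= 1 + m/(q+1), cleared of denominators; it is applied
   with m = q+2 = r. *)
have bernoulli m : q.+1 ^ m * (q.+1 + m) <= q.+1 * q.+2 ^ m.
  elim: m => [|m IHm]; first by rewrite !expn0 addn0 mul1n muln1.
  rewrite !expnSr mulnA; apply: leq_trans (leq_mul IHm (leqnn q.+2)).
  by rewrite -!mulnA leq_pmul2l ?expn_gt0 //; nia.
rewrite -(leq_pmul2l (ltn0Sn q)); apply: leq_trans (bernoulli q.+2).
by rewrite mulnA (mulnC _ (_ ^ _)) leq_pmul2l ?expn_gt0 //; lia.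
Qed.

Lemma leq_card_bigcup (I T : finType) (P : pred I) (F : I -> {set T}) :
  #|\bigcup_(i | P i) F i| <= \sum_(i | P i) #|F i|.
Proof.
apply: (big_ind2 (fun (A : {set T}) n => #|A| <= n)) => [|A m B n leA leB|//].
  by rewrite cards0.
by apply: leq_trans (leq_card_setU A B).1 (leq_add leA leB).
Qed.

Lemma card_ffun_avoid (T I : finType) (A B : {set T}) :
  #|[set f : {ffun T * I -> T} | [forall xi, (xi.1 \in A) ==> (f xi \notin B)]]|
  = (#|T| - #|B|) ^ (#|A| * #|I|) * #|T| ^ ((#|T| - #|A|) * #|I|).
Proof.
pose F (xi : T * I) := [pred y | (xi.1 \in A) ==> (y \notin B)].
rewrite cardsE.
have -> : #|[pred f : {ffun T * I -> T} |
             [forall xi, (xi.1 \in A) ==> (f xi \notin B)]]| = #|family F|.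
  by apply: eq_card => f; rewrite inE.
rewrite card_family foldrE big_map big_enum /=.
rewrite (bigID (fun xi => xi \in setX A [set: I])) /=.
have cardT : #|{: T * I}| = #|T| * #|I| by rewrite card_prod.
congr (_ * _).
- rewrite (eq_bigr (fun=> #|T| - #|B|)) => [|xi]; last first.
    rewrite !inE andbT => xA; rewrite -(cardsC B) addKn.
    by apply: eq_card => y; rewrite !inE xA.
  by rewrite prod_nat_const cardsX cardsT.
- rewrite (eq_bigr (fun=> #|T|)) => [|xi]; last first.
    rewrite !inE andbT => xA; apply: eq_card => y; by rewrite !inE (negbTE xA).
  rewrite prod_nat_const; congr (_ ^ _).
  have := cardC (mem (setX A [set: I])).
  rewrite cardT cardsX cardsT mulnBl => <-; rewrite addKn.
  by apply: eq_card => xi; rewrite !inE.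
Qed.

(** Union bound over the pairs (A, B): the maps with no value on A landing in B are too few to
    exhaust all maps, even summed over all pairs of large sets. *)
Lemma exists_mixing_map (r s : nat) : 0 < r -> 0 < s ->
  exists f : {ffun 'I_(r * s) * 'I_(3 * r ^ 2) -> 'I_(r * s)},
    forall A B : {set 'I_(r * s)}, s <= #|A| -> s <= #|B| ->
      exists x i, x \in A /\ f (x, i) \in B.
Proof.
move=> r_gt0 s_gt0; set N := r * s; set d := 3 * r ^ 2.
have N_gt0 : 0 < N by rewrite muln_gt0 r_gt0.
pose avoid (AB : {set 'I_N} * {set 'I_N}) :=
  [set f : {ffun 'I_N * 'I_d -> 'I_N} |
     [forall xi, (xi.1 \in AB.1) ==> (f xi \notin AB.2)]].
pose large (AB : {set 'I_N} * {set 'I_N}) := (s <= #|AB.1|) && (s <= #|AB.2|).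
pose bad := \bigcup_(AB | large AB) avoid AB.
have cardF : #|{ffun 'I_N * 'I_d -> 'I_N}| = N ^ (N * d).
  by rewrite card_ffun card_prod !card_ord.
have avoid_le AB : large AB ->
    #|avoid AB| * 2 ^ (2 * N).+1 <= N ^ (N * d).
  case: AB => A B /andP[/= sA sB].
  have A_le : #|A| <= N by rewrite -[X in _ <= X]card_ord max_card.
  rewrite card_ffun_avoid !card_ord -/N -/d mulnAC.
  have -> : N ^ (N * d) = N ^ (#|A| * d) * N ^ ((N - #|A|) * d).
    by rewrite -expnD -mulnDl subnKC.
  rewrite leq_mul2r; apply/orP; right.
  set a := #|A| in sA A_le *.
  (* The proportion of avoiding maps is at most (1 - 1/r)^(a d). The a d factors form 3ra groups of
     r, each group contributing at most 1/2, and 3ra >= 3N >= 2N + 1 because a >= s. *)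
  have -> : a * d = r * (3 * r * a) by rewrite /d expnS expn1; nia.
  have Nb : N - #|B| <= r.-1 * s by rewrite /N -subn1 mulnBl mul1n leq_sub2l.
  have -> : N ^ (r * (3 * r * a)) = (r ^ r) ^ (3 * r * a) * s ^ (r * (3 * r * a)).
    by rewrite /N expnMn -expnM.
  apply: (@leq_trans ((2 * r.-1 ^ r) ^ (3 * r * a) * s ^ (r * (3 * r * a)))).
    rewrite expnMn -expnM -(mulnA (2 ^ _)) -expnMn (mulnC _ (2 ^ _)) leq_mul //.
      by rewrite leq_pexp2l //; rewrite /N; nia.
    by rewrite leq_exp2r ?muln_gt0 ?r_gt0 //; lia.
  rewrite leq_mul2r leq_exp2r ?double_expn_pred ?orbT //.
  by rewrite !muln_gt0 r_gt0 /=; lia.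
have bad_lt : #|bad| < N ^ (N * d).
  have X_gt0 : 0 < N ^ (N * d) by rewrite expn_gt0 N_gt0.
  (* There are at most 2^(2N) pairs of sets; the spare factor 2 makes the final inequality
     strict. *)
  have : #|bad| * 2 ^ (2 * N).+1 <= 2 ^ (2 * N) * N ^ (N * d).
    apply: (@leq_trans (\sum_(AB | large AB)
        #|avoid AB| * 2 ^ (2 * N).+1)).
      by rewrite -big_distrl leq_mul2r /bad leq_card_bigcup orbT.
    apply: (@leq_trans (\sum_(AB | large AB) N ^ (N * d))).
      by apply: leq_sum => AB; apply: avoid_le.
    rewrite sum_nat_const leq_mul2r; apply/orP; right.
    apply: leq_trans (max_card _) _.
    by rewrite card_prod -cardsT -powersetT card_powerset cardsT card_ord
       -expnD addnn -mul2n.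
  rewrite expnS [X in X <= _]mulnA [X in X <= _]mulnC leq_pmul2l ?expn_gt0 //.
  by lia.
have [f f_good] : exists f, f \notin bad.
  apply/existsP; rewrite -negb_forall; apply: contraL bad_lt => /forallP all_bad.
  by rewrite -leqNgt -cardF; apply/subset_leq_card/subsetP => f _; apply: all_bad.
exists f => A B sA sB.
have [/existsP[x /existsP[i /andP[]]]|none] :=
  boolP [exists x, exists i, (x \in A) && (f (x, i) \in B)]; first by exists x, i.
case/negP: f_good.
apply/bigcupP; exists (A, B); first by rewrite /large /= sA sB.
rewrite inE; apply/forallP => -[x i] /=; apply/implyP => xA.
apply: contra none => fB; apply/existsP; exists x.
by apply/existsP; exists i; rewrite xA.
Qed.

(** Out-degrees of a mixing map are at most [d]; in-degrees are controlled by keeping only [n]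
    points with light fibers. Mixing survives, since the embedding [g] of these points preserves
    cardinalities. *)
Lemma exists_sparse_mixing_rel (n r s : nat) :
    0 < r -> 0 < s -> 2 * n <= r * s ->
  exists h : rel 'I_n,
    [/\ forall x, #|[set y | h x y]| <= 6 * r ^ 2,
        forall y, #|[set x | h x y]| <= 6 * r ^ 2 &
        forall A B : {set 'I_n}, s <= #|A| -> s <= #|B| ->
          exists x y, [/\ x \in A, y \in B & h x y]].
Proof.
move=> r_gt0 s_gt0; have := exists_mixing_map r_gt0 s_gt0.
set N := r * s; set d := 3 * r ^ 2 => -[f f_mixing] le_nN.
have -> : 6 * r ^ 2 = 2 * d by rewrite /d mulnA.
have d_gt0 : 0 < d by rewrite muln_gt0 expn_gt0 r_gt0.
pose fib y := [set xi | f xi == y].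
pose light := [set y | #|fib y| <= 2 * d].
have sum_fib : \sum_y #|fib y| = N * d.
  rewrite -[N in RHS]card_ord -[d in RHS]card_ord -card_prod -sum1_card.
  rewrite (partition_big f xpredT) //=; apply: eq_bigr => y _.
  by rewrite sum1dep_card.
(* Fewer than half of the points have a fiber of more than twice the mean size. *)
have n_le : n <= #|light|.
  have : \sum_(y in ~: light) (2 * d).+1 <= N * d.
    rewrite -sum_fib [X in _ <= X](bigID (mem (~: light))) /=.
    apply: leq_trans (leq_addr _ _); apply: leq_sum => y.
    by rewrite !inE -ltnNge.
  rewrite sum_nat_const => heavy.
  by have := cardsC light; rewrite card_ord; nia.
pose g (i : 'I_n) := enum_val (widen_ord n_le i).
have g_inj : injective g.
  by move=> i j /enum_val_inj /(congr1 val) /= /val_inj.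
have g_light i : #|fib (g i)| <= 2 * d.
  by have := enum_valP (widen_ord n_le i); rewrite inE.
exists (fun x y => [exists i, f (g x, i) == g y]); split.
- move=> x; rewrite -(card_imset _ g_inj).
  apply: (@leq_trans #|[set f (g x, i) | i : 'I_d]|).
    apply/subset_leq_card/subsetP => _ /imsetP[y + ->].
    by rewrite inE => /existsP[i /eqP <-]; apply: imset_f.
  by apply: leq_trans (leq_imset_card _ _) _; rewrite card_ord; lia.
- move=> y; rewrite -(card_imset _ g_inj); apply: leq_trans (g_light y).
  apply: leq_trans (leq_imset_card fst _).
  apply/subset_leq_card/subsetP => _ /imsetP[x + ->].
  rewrite inE => /existsP[i fxi]; apply/imsetP.
  by exists (g x, i); rewrite // inE.
- move=> A B sA sB.
  rewrite -(card_imset _ g_inj) in sA; rewrite -(card_imset _ g_inj) in sB.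
  have [_ [i [/imsetP[x xA ->] /imsetP[y yB fy]]]] := f_mixing _ _ sA sB.
  by exists x, y; split=> //; apply/existsP; exists i; rewrite fy.
Qed.

(** * Closing a relation layer by layer, with degree bounds *)

Section Closure.
Variables (T : finType) (p : T -> nat) (h : rel T).

(* Step j only adds pairs starting strictly above layer j, so the pairs starting
   in layer j are final after j steps. *)
Fixpoint lower_closure i : rel T :=
  if i is j.+1 then fun x y => lower_closure j x y ||
    [&& j < p x, p x < p y &
        [exists a, [&& p a == j, lower_closure j a x & lower_closure j a y]]]
  else fun x y => h x y && (p x < p y).

Lemma lower_closure_lt i x y : lower_closure i x y -> p x < p y.
Proof.
by elim: i => [|i IHi] /= => [/andP[]//|/orP[/IHi//|/and3P[]]].
Qed.

Lemma sub_lower_closure i x y : h x y -> p x < p y -> lower_closure i x y.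
Proof. by move=> hxy lxy; elim: i => [|i IHi] /=; rewrite ?hxy ?IHi. Qed.

Lemma lower_closure_stable i j x y : p x <= i -> i <= j ->
  lower_closure j x y = lower_closure i x y.
Proof.
move=> le_xi; elim: j => [|j IHj]; first by rewrite leqn0 => /eqP ->.
rewrite leq_eqVlt => /predU1P[-> //|le_ij] /=; rewrite ltnS in le_ij.
by rewrite IHj // ltnNge (leq_trans le_xi le_ij) orbF.
Qed.

Lemma lower_closure_mono i j x y : i <= j ->
  lower_closure i x y -> lower_closure j x y.
Proof.
move/subnKC <-; elim: (j - i) => [|m IHm]; first by rewrite addn0.
by rewrite addnS /= => /IHm ->.
Qed.

(** The pairs starting at [a] are already final after [p a] steps, so the next step, which treats
    the layer of [a], adds the pair (x, y). *)
Lemma lower_closure_closed k a x y : p x <= k -> p x < p y ->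
  lower_closure k a x -> lower_closure k a y -> lower_closure k x y.
Proof.
move=> le_xk lt_xy ax ay.
have lt_ax := lower_closure_lt ax; have lt_ak := leq_trans lt_ax le_xk.
rewrite !(lower_closure_stable _ (leqnn (p a)) (ltnW lt_ak)) in ax ay.
apply: lower_closure_mono lt_ak _; rewrite /= lt_ax lt_xy; apply/orP; right.
by apply/existsP; exists a; rewrite eqxx ax ay.
Qed.

Lemma card_lower_closure k D :
    (forall x, #|[set y | h x y]| <= D) -> (forall y, #|[set x | h x y]| <= D) ->
    0 < D ->
  forall x, #|[set y | lower_closure k x y]| <= (2 * D) ^ (2 ^ k) /\
            #|[set y | lower_closure k y x]| <= (2 * D) ^ (2 ^ k).
Proof.
move=> outD inD D_gt0.
(* A new neighbour of x, on either side, is reached by stepping back to some a and then forward, so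
   a degree bound d becomes d + d^2. Doubling turns this into squaring: if 2d <= X and X >= 2, then
   2(d + d^2) <= X^2. *)
suff: forall x, 2 * #|[set y | lower_closure k x y]| <= (2 * D) ^ (2 ^ k) /\
                2 * #|[set y | lower_closure k y x]| <= (2 * D) ^ (2 ^ k).
  by move=> deg x; have [] := deg x; lia.
elim: k => [|k IHk] x.
  rewrite expn0 expn1 !leq_pmul2l //=; split.
    apply: leq_trans (outD x); apply/subset_leq_card/subsetP => y.
    by rewrite !inE => /andP[].
  apply: leq_trans (inD x); apply/subset_leq_card/subsetP => y.
  by rewrite !inE => /andP[].
set X := (2 * D) ^ (2 ^ k) in IHk.
have -> : (2 * D) ^ (2 ^ k.+1) = X * X by rewrite /X -expnD addnn -mul2n -expnS.
have X_gt1 : 1 < X.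
  apply: (@leq_trans (2 * D)); first by lia.
  by rewrite /X -{1}[2 * D]expn1 leq_pexp2l ?expn_gt0 // muln_gt0.
have step (Z A : {set T}) (F : T -> {set T}) : 2 * #|A| <= X ->
    (forall a, 2 * #|F a| <= X) -> 2 * #|Z| <= X ->
    2 * #|Z :|: \bigcup_(a in A) F a| <= X * X.
  move=> leA leF leZ; have := (leq_card_setU Z (\bigcup_(a in A) F a)).1.
  have : 2 * #|\bigcup_(a in A) F a| <= #|A| * X.
    apply: (@leq_trans (\sum_(a in A) 2 * #|F a|)).
      by rewrite -big_distrr leq_mul2l leq_card_bigcup.
    by rewrite -sum_nat_const leq_sum.
  nia.
split.
  apply: leq_trans (step [set y | lower_closure k x y] [set a | lower_closure k a x]
    (fun a => [set y | lower_closure k a y]) _ _ _); last 3 first.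
  - exact: (IHk x).2.
  - by move=> a; exact: (IHk a).1.
  - exact: (IHk x).1.
  rewrite leq_mul2l; apply/subset_leq_card/subsetP => y.
  rewrite !inE /= => /orP[-> //|/and3P[_ _ /existsP[a /and3P[_ ax ay]]]].
  by apply/orP; right; apply/bigcupP; exists a; rewrite inE.
apply: leq_trans (step [set y | lower_closure k y x] [set a | lower_closure k a x]
  (fun a => [set y | lower_closure k a y]) _ _ _); last 3 first.
- exact: (IHk x).2.
- by move=> a; exact: (IHk a).1.
- exact: (IHk x).2.
rewrite leq_mul2l; apply/subset_leq_card/subsetP => y.
rewrite !inE /= => /orP[-> //|/and3P[_ _ /existsP[a /and3P[_ ay ax]]]].
by apply/orP; right; apply/bigcupP; exists a; rewrite inE.
Qed.

End Closure.

(** * The layered graph: degrees, bi-cliques, forbidden subgraphs *)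

Lemma induced_lt (j n : nat) (f : 'I_j -> 'I_n) :
  injective f -> {homo f : x y / (x <= y)%O} -> {homo f : x y / x < y}.
Proof.
move=> f_inj f_mono x y lt_xy; rewrite ltn_neqAle; apply/andP; split.
  by apply: contraTneq lt_xy => /val_inj/f_inj ->; rewrite ltnn.
exact: f_mono (ltnW lt_xy).
Qed.

Section LayeredGraph.
Variables (n : nat) (p : 'I_n -> nat) (E : rel 'I_n).

Definition layered_adj : rel 'I_n := fun x y =>
  (x != y) && [|| p x == p y, E x y | E y x].

Lemma layered_adj_sym : symmetric layered_adj.
Proof.
move=> x y; rewrite /layered_adj eq_sym [p x == _]eq_sym.
by rewrite [E x y || _]orbC.
Qed.

Lemma layered_adj_irr : irreflexive layered_adj.
Proof. by move=> x; rewrite /layered_adj eqxx. Qed.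

Definition layered_graph : ordered_graph :=
  OrderedGraph layered_adj_sym layered_adj_irr.

Lemma max_degree_layered_graph m d :
    (forall x, #|[set y | p x == p y]| <= m) ->
    (forall x, #|[set y | E x y]| <= d) -> (forall y, #|[set x | E x y]| <= d) ->
  max_degree layered_graph <= m + 2 * d.
Proof.
move=> layer_le out_le in_le; apply/bigmax_leqP => x _ /=.
have sub : [set y | layered_adj x y] \subset
    [set y | p x == p y] :|: ([set y | E x y] :|: [set y | E y x]).
  by apply/subsetP => y; rewrite !inE => /andP[].
apply: leq_trans (subset_leq_card sub) _.
apply: leq_trans (leq_card_setU _ _).1 (leq_add (layer_le x) _).
by apply: leq_trans (leq_card_setU _ _).1 _; rewrite mul2n -addnn leq_add.
Qed.

Lemma max_biclique_layered_graph k s :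
    (forall x, p x < k) -> 0 < s ->
    (forall A B : {set 'I_n}, s <= #|A| -> s <= #|B| ->
       (forall x y, x \in A -> y \in B -> p x < p y) ->
       exists x y, [/\ x \in A, y \in B & E x y]) ->
  max_biclique_size (complement layered_graph) <= k * s.
Proof.
move=> p_lt s_gt0 mixing; apply/bigmax_leqP => -[A B] /=.
(* Vertices of the complement are ['I_n] by conversion; only the displayed types change. *)
move: A B; change (forall A B : {set 'I_n},
  @biclique (complement layered_graph) A B -> #|A| <= k * s) => A B.
move=> /and3P[disjAB /eqP cardAB /forall_inP complAB].
rewrite leqNgt; apply/negP => A_gt.
have layer_large (C : {set 'I_n}) : k * s < #|C| ->
    exists i : nat, s <= #|[set x in C | p x == i]|.
  move=> C_gt; suff /existsP[i] : [exists i : 'I_k, s <= #|[set x in C | p x == i]|].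
    by exists i.
  apply: contraLR C_gt => /existsPn small; rewrite -leqNgt.
  rewrite -sum1_card (partition_big (fun x => Ordinal (p_lt x)) xpredT) //=.
  rewrite -[k in k * s]card_ord -sum_nat_const; apply: leq_sum => i _.
  rewrite sum1dep_card; have := small i; rewrite -ltnNge => /ltnW.
  by apply: leq_trans; apply: subset_leq_card; apply/subsetP => x; rewrite !inE.
have [i Ai] := layer_large A A_gt.
have [j Bj] : exists j : nat, s <= #|[set x in B | p x == j]|.
  by apply: layer_large; rewrite -cardAB.
have no_edge x y : x \in A -> y \in B -> layered_adj x y = false.
  by move=> xA yB; have /forall_inP/(_ y yB)/andP[_ /negbTE] := complAB x xA.
(* Different layers are joined by mixing, from the lower to the higher. In a common layer, any point
   of A and any point of B are adjacent unless equal, which disjointness forbids. *)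
case: (ltngtP i j) => [lt_ij|lt_ji|eq_ij].
- have [|x [y []]] := mixing _ _ Ai Bj.
    by move=> x y; rewrite !inE => /andP[_ /eqP->] /andP[_ /eqP->].
  rewrite !inE => /andP[xA /eqP px] /andP[yB /eqP py] Exy.
  have := no_edge x y xA yB; rewrite /layered_adj Exy orbT andbT.
  by move/negbFE/eqP => eq_xy; rewrite -px -py eq_xy ltnn in lt_ij.
- have [|y [x []]] := mixing _ _ Bj Ai.
    by move=> x y; rewrite !inE => /andP[_ /eqP->] /andP[_ /eqP->].
  rewrite !inE => /andP[yB /eqP py] /andP[xA /eqP px] Eyx.
  have := no_edge x y xA yB; rewrite /layered_adj Eyx !orbT andbT.
  by move/negbFE/eqP => eq_xy; rewrite -px -py eq_xy ltnn in lt_ji.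
- have /card_gt0P[x] := leq_trans s_gt0 Ai.
  have /card_gt0P[y] := leq_trans s_gt0 Bj.
  rewrite !inE => /andP[yB /eqP py] /andP[xA /eqP px].
  have := no_edge x y xA yB; rewrite /layered_adj px py eq_ij eqxx andbT.
  by move/negbFE/eqP => eq_xy; rewrite -eq_xy (disjointFr disjAB xA) in yB.
Qed.

Hypothesis p_mono : {homo p : x y / x <= y}.
Hypothesis E_lt : forall x y, E x y -> p x < p y.
Hypothesis E_closed : forall a x y, p x < p y -> E a x -> E a y -> E x y.

(** Both adjacencies at [a] must come from [E]. Then [d] lies either in the layer of [c], a clique,
    or strictly above it, where closedness of [E] applies. *)
Lemma layered_forward_adj (a c d : 'I_n) : p a < p c -> c < d ->
  layered_adj a c -> layered_adj a d -> layered_adj c d.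
Proof.
move=> lt_ac lt_cd /andP[_ ac] /andP[_ ad]; have le_cd := p_mono (ltnW lt_cd).
have Eforward z : p a < p z -> [|| p a == p z, E a z | E z a] -> E a z.
  by move=> lt_az /or3P[/eqP|//|/E_lt]; lia.
apply/andP; split; first by apply: contraTneq lt_cd => ->; rewrite ltnn.
move: le_cd; rewrite leq_eqVlt => /predU1P[->|lt_pcd]; first by rewrite eqxx.
have Eac := Eforward c lt_ac ac.
have Ead := Eforward d (ltn_trans lt_ac lt_pcd) ad.
by rewrite (E_closed lt_pcd Eac Ead) orbT.
Qed.

Lemma nonadj_layer_lt (x y : 'I_n) : x < y -> ~~ layered_adj x y -> p x < p y.
Proof.
move=> lt_xy; rewrite negb_and negbK => /orP[/eqP eq_xy|].
  by rewrite eq_xy ltnn in lt_xy.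
by rewrite !negb_or => /and3P[ne _ _]; rewrite ltn_neqAle ne p_mono // ltnW.
Qed.

(** The non-edge 23 puts 3 in a higher layer than 2, hence than 1; the edges 13 and 14 then force
    the edge 34. Label i is the ordinal i - 1. *)
Lemma layered_graph_S_free : ~ induced_ordered_subgraph graph_S layered_graph.
Proof.
case=> f [f_inj f_mono f_adj].
have f_lt := induced_lt f_inj f_mono.
have lt01 := f_lt (@Ordinal 4 0 isT) (@Ordinal 4 1 isT) isT.
have lt12 := f_lt (@Ordinal 4 1 isT) (@Ordinal 4 2 isT) isT.
have lt23 := f_lt (@Ordinal 4 2 isT) (@Ordinal 4 3 isT) isT.
have adj02 := f_adj (@Ordinal 4 0 isT) (@Ordinal 4 2 isT).
have adj03 := f_adj (@Ordinal 4 0 isT) (@Ordinal 4 3 isT).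
have adj12 := f_adj (@Ordinal 4 1 isT) (@Ordinal 4 2 isT).
have adj23 := f_adj (@Ordinal 4 2 isT) (@Ordinal 4 3 isT).
have lt_p12 := nonadj_layer_lt lt12 (negbT adj12).
have lt_p02 := leq_ltn_trans (p_mono (ltnW lt01)) lt_p12.
have := layered_forward_adj lt_p02 lt23 adj02 adj03.
by rewrite [layered_adj _ _]adj23.
Qed.

(** Same contradiction at 34, with the non-edge 12 now separating 1 from 3. *)
Lemma layered_graph_P_free : ~ induced_ordered_subgraph graph_P layered_graph.
Proof.
case=> f [f_inj f_mono f_adj].
have f_lt := induced_lt f_inj f_mono.
have lt01 := f_lt (@Ordinal 4 0 isT) (@Ordinal 4 1 isT) isT.
have lt12 := f_lt (@Ordinal 4 1 isT) (@Ordinal 4 2 isT) isT.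
have lt23 := f_lt (@Ordinal 4 2 isT) (@Ordinal 4 3 isT) isT.
have adj02 := f_adj (@Ordinal 4 0 isT) (@Ordinal 4 2 isT).
have adj03 := f_adj (@Ordinal 4 0 isT) (@Ordinal 4 3 isT).
have adj01 := f_adj (@Ordinal 4 0 isT) (@Ordinal 4 1 isT).
have adj23 := f_adj (@Ordinal 4 2 isT) (@Ordinal 4 3 isT).
have lt_p02 := leq_trans (nonadj_layer_lt lt01 (negbT adj01)) (p_mono (ltnW lt12)).
have := layered_forward_adj lt_p02 lt23 adj02 adj03.
by rewrite [layered_adj _ _]adj23.
Qed.

End LayeredGraph.

(** * Assembly and choice of parameters *)

Lemma exists_layered_graph (n m k r s : nat) :
    0 < m -> n <= k * m -> 0 < r -> 0 < s -> 2 * n <= r * s ->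
  exists G : ordered_graph,
    [/\ #|G| = n,
        max_degree G <= m + 2 * (12 * r ^ 2) ^ (2 ^ k),
        max_biclique_size (complement G) <= k * s,
        ~ induced_ordered_subgraph graph_S G &
        ~ induced_ordered_subgraph graph_P G].
Proof.
move=> m_gt0 le_n_km r_gt0 s_gt0 le_n_rs.
have [h [out_h in_h h_mixing]] := exists_sparse_mixing_rel r_gt0 s_gt0 le_n_rs.
pose p (x : 'I_n) := x %/ m.
have p_lt x : p x < k by rewrite ltn_divLR // (leq_trans (ltn_ord x)).
have p_mono : {homo p : x y / x <= y} by move=> x y /(leq_div2r m).
pose E := lower_closure p h k.
have E_lt x y : E x y -> p x < p y by apply: lower_closure_lt.
have E_closed a x y : p x < p y -> E a x -> E a y -> E x y.
  by apply: lower_closure_closed; apply: ltnW.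
have D_gt0 : 0 < 6 * r ^ 2 by rewrite muln_gt0 expn_gt0 r_gt0.
have deg_E := card_lower_closure p k out_h in_h D_gt0.
exists (layered_graph p E); split.
- by rewrite card_ord.
- rewrite -[12]/(2 * 6) -[2 * 6 * _]mulnA.
  apply: max_degree_layered_graph => [x|x|x]; [|exact: (deg_E x).1|exact: (deg_E x).2].
  (* The remainder modulo [m] is injective on a layer, so a layer has at most [m] points. *)
  pose rem (y : 'I_n) : 'I_m := Ordinal (ltn_pmod y m_gt0).
  rewrite -[X in _ <= X]card_ord -(@card_in_imset _ _ rem) ?max_card //.
  move=> y z; rewrite !inE /p => /eqP xy /eqP xz [eq_yz]; apply: val_inj => /=.
  by rewrite (divn_eq y m) (divn_eq z m) -xy -xz eq_yz.
- apply: max_biclique_layered_graph => // A B sA sB lt_AB.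
  have [x [y [xA yB hxy]]] := h_mixing A B sA sB.
  by exists x, y; split=> //; apply: sub_lower_closure; rewrite ?lt_AB.
- exact: layered_graph_S_free.
- exact: layered_graph_P_free.
Qed.

Lemma exists_floor_root (e n : nat) : 0 < e -> exists r, r ^ e <= n < r.+1 ^ e.
Proof.
move=> e_gt0.
have ex0 : exists r, r ^ e <= n by exists 0; rewrite exp0n.
have bounded r : r ^ e <= n -> r <= n.
  by apply: leq_trans; case: r => // r; rewrite -{1}[r.+1]expn1 leq_pexp2l.
have [r le_rn r_max] := ex_maxnP ex0 bounded.
by exists r; rewrite le_rn ltnNge; apply/negP => /r_max; rewrite ltnn.
Qed.

Lemma exists_large_layered_graph (k n : nat) (K := 2 ^ k) :
    0 < k -> (18 * k ^ 2 * 12 ^ K) ^ (4 * K) <= n ->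
  exists G : ordered_graph,
    [/\ #|G| = n,
        max_degree G * k <= 4 * n,
        max_biclique_size (complement G) ^ (8 * K) * n <= n ^ (8 * K),
        ~ induced_ordered_subgraph graph_S G &
        ~ induced_ordered_subgraph graph_P G].
Proof.
set r0 := 18 * k ^ 2 * 12 ^ K => k_gt0 le_r0n.
have K_gt0 : 0 < K by rewrite expn_gt0.
have r0_gt0 : 0 < r0 by rewrite !muln_gt0 !expn_gt0 k_gt0.
have K4_gt0 : 0 < 4 * K by rewrite muln_gt0.
have [r /andP[le_rn lt_nr]] := exists_floor_root n K4_gt0.
have le_r0r : r0 <= r.
  by rewrite -ltnS -(ltn_exp2r _ _ K4_gt0) (leq_ltn_trans le_r0n).
have r_gt0 := leq_trans r0_gt0 le_r0r.
have le_r_n : r <= n.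
  by apply: leq_trans le_rn; rewrite -{1}[r]expn1 leq_pexp2l.
have exp12_gt0 : 0 < 12 ^ K by rewrite expn_gt0.
(* [r0] is chosen to give these two bounds: the first serves the degree, the second the
   bi-clique. *)
have le_kr : k * 12 ^ K <= r by apply: leq_trans le_r0r; rewrite /r0; nia.
have le_k2r : 18 * k ^ 2 <= r by apply: leq_trans le_r0r; rewrite /r0; nia.
set m := (n %/ k).+1; set s := (2 * n %/ r).+1.
have m_ge : n <= k * m by rewrite mulnC ltnW ?ltn_ceil.
have s_ge : 2 * n <= r * s by rewrite (mulnC r) ltnW ?ltn_ceil.
have [G [cardG deg_le bi_le S_free P_free]] :=
  exists_layered_graph (ltn0Sn _) m_ge r_gt0 (ltn0Sn _) s_ge.
exists G; split=> //.
- apply: leq_trans (leq_mul deg_le (leqnn k)) _.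
  have m_le : m * k <= 2 * n.
    have := leq_trunc_div n k; have : k <= n by nia.
    by rewrite /m; lia.
  (* Here k 12^K <= r <= r^(2K), so the product is at most r^(4K) <= n. *)
  suff : k * (12 * r ^ 2) ^ K <= n by rewrite -/K; nia.
  rewrite expnMn mulnA -expnM; apply: leq_trans le_rn.
  have -> : 4 * K = 2 * K + 2 * K by lia.
  rewrite expnD leq_mul2r; apply/orP; right.
  by apply: leq_trans le_kr _; rewrite -{1}[r]expn1 leq_pexp2l // muln_gt0.
- set M := max_biclique_size _ in bi_le *.
  have s_le : r * s <= 3 * n.
    by have := leq_trunc_div (2 * n) r; rewrite /s; nia.
  have Mr_le : M * r <= 3 * k * n by nia.
  (* From M r <= 3kn and 9k^2 (r+1) <= 18k^2 r <= r^2. Raising to the power 4K and using n <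
     (r+1)^(4K) yields the claim. *)
  have sq_le : M ^ 2 * r.+1 <= n ^ 2.
    rewrite -(leq_pmul2l (_ : 0 < 9 * k ^ 2)) ?muln_gt0 ?expn_gt0 ?k_gt0 //.
    apply: (@leq_trans ((M * r) ^ 2)).
      have : 9 * k ^ 2 * r.+1 <= r ^ 2 by nia.
      by move=> le_r; rewrite expnMn mulnCA; apply: leq_mul (leqnn _) le_r.
    by apply: leq_trans (leq_mul Mr_le Mr_le) _; rewrite !expnS !expn0; nia.
  have -> : 8 * K = 2 * (4 * K) by lia.
  rewrite !(expnM _ 2 (4 * K)); apply: leq_trans (_ : (M ^ 2 * r.+1) ^ (4 * K) <= _).
    by rewrite expnMn leq_mul2l ltnW ?orbT.
  by rewrite leq_exp2r.
Qed.

(** * Passage to real exponents *)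

Local Open Scope ring_scope.

Lemma natr_le_powR (R : realType) (M n e : nat) :
    (0 < n)%N -> (0 < e)%N -> (M ^ e * n <= n ^ e)%N ->
  M%:R <= n%:R `^ (1 - e%:R^-1) :> R.
Proof.
move=> n_gt0 e_gt0 le_Mn; have n_pos : 0 < n%:R :> R by rewrite ltr0n.
have e_neq0 : e%:R != 0 :> R by rewrite pnatr_eq0 -lt0n.
rewrite -(ler_pXn2r e_gt0) ?nnegrE ?powR_ge0 ?ler0n //.
rewrite -[X in _ <= X]powR_mulrn ?powR_ge0 // -powRrM mulrBl mul1r mulVf //.
rewrite powRB ?(gt_eqF n_pos) ?implybT // powRr1 ?(ltW n_pos) // powR_mulrn ?(ltW n_pos) //.
by rewrite ler_pdivlMr // -!natrX -natrM ler_nat.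
Qed.

Theorem theorem3 (R : realType) (eps : R) (eps_gt0 : 0 < eps) :
  exists (delta : R) (n0 : nat),
    0 < delta /\
    forall n : nat, (0 < n)%N -> (n0 <= n)%N ->
      exists G : ordered_graph,
        [/\ #|G| = n,
            (max_degree G)%:R <= eps * n%:R,
            (max_biclique_size (complement G))%:R <= n%:R `^ (1 - delta),
            ~ induced_ordered_subgraph graph_S G &
            ~ induced_ordered_subgraph graph_P G].
Proof.
(* This [k] exceeds 4/eps, so a degree bound of 4n/k is at most eps n; [delta] is 1/(8K). *)
set k := (Num.truncn (4 / eps)).+1; set K := (2 ^ k)%N.
have K8_gt0 : (0 < 8 * K)%N by rewrite muln_gt0 expn_gt0.
exists (8 * K)%:R^-1, ((18 * k ^ 2 * 12 ^ K) ^ (4 * K))%N; split.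
  by rewrite invr_gt0 ltr0n.
move=> n n_gt0 n_ge.
have [G [cardG deg_le bi_le S_free P_free]] :=
  exists_large_layered_graph (ltn0Sn _) n_ge.
exists G; split=> //; last exact: natr_le_powR.
have k_pos : 0 < k%:R :> R by rewrite ltr0n.
have eps_k : 4 <= eps * k%:R.
  by rewrite mulrC -ler_pdivrMr // ltW // truncnS_gt.
rewrite -(ler_pM2r k_pos) mulrAC -natrM.
apply: le_trans (_ : 4 * n%:R <= _); first by rewrite -natrM ler_nat.
by rewrite ler_wpM2r.
Qed.
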